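(* Let $X$ be a compact topological space, let $\mu$ be a Borel probability measure on $X$, let $P, K \subseteq \operatorname{Homeo}_\mu(X)$, and suppose that $\mu$ is the unique Borel probability measure on $X$ that is invariant under all elements of $K$. Then $E_K(P) \subseteq \operatorname{Homeo}_\mu(X)$.
   Context: For a topological space $X$, $\operatorname{Homeo}(X)$ is the set of all homeomorphisms $X \to X$, and for a Borel measure $\mu$ on $X$, $\operatorname{Homeo}_\mu(X)$ is the set of all $f \in \operatorname{Homeo}(X)$ that preserve $\mu$, i.e. $\mu(f^{-1}(B)) = \mu(B)$ for every Borel set $B$. For $K, P \subseteq \operatorname{Homeo}_\mu(X)$, the normalizer from $K$ to $P$ is $$E_K(P) = \{ f \in \operatorname{Homeo}(X) : fK \subseteq Pf \},$$ where $fK = \{f \circ k : k \in K\}$ and $Pf = \{p \circ f : p \in P\}$. *)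

(* Defs.v *)
From mathcomp Require Import all_boot all_order all_algebra.
From mathcomp Require Import all_classical all_reals all_analysis.

Set Implicit Arguments.
Unset Strict Implicit.
Unset Printing Implicit Defensive.

Local Open Scope classical_set_scope.
Local Open Scope ring_scope.

(* Measurable types are pointed in the library, so spaces are taken pointed.
   The point is not used: a space carrying a probability measure is nonempty. *)
Notation borel X := (g_sigma_algebraType (@open X)).

Definition Homeo (X : topologicalType) : set (X -> X) :=
  [set f | continuous f /\
    exists g : X -> X, [/\ cancel f g, cancel g f & continuous g]].

(* A measure is a total function on [set (borel X)] whose values outside the
   Borel sets carry no meaning, hence the restriction to Borel [B] here and in
   [unique_invariant]. *)
Definition preserves (R : realType) (X : ptopologicalType)
    (mu : {measure set (borel X) -> \bar R}) (f : X -> X) : Prop :=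
  forall B : set (borel X), measurable B -> mu (f @^-1` B) = mu B.

Definition Homeo_mu (R : realType) (X : ptopologicalType)
    (mu : {measure set (borel X) -> \bar R}) : set (X -> X) :=
  [set f | Homeo f /\ preserves mu f].

Definition normalizer (X : topologicalType) (K P : set (X -> X)) :
    set (X -> X) :=
  [set f | Homeo f /\
    [set f \o k | k in K] `<=` [set p \o f | p in P]].

Definition invariant_under (R : realType) (X : ptopologicalType)
    (K : set (X -> X)) (mu : {measure set (borel X) -> \bar R}) : Prop :=
  forall k, K k -> preserves mu k.

Definition unique_invariant (R : realType) (X : ptopologicalType)
    (K : set (X -> X)) (mu : probability (borel X) R) : Prop :=
  invariant_under K mu /\
  forall nu : probability (borel X) R, invariant_under K nu ->
    forall B : set (borel X), measurable B -> nu B = mu B.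

(* Main.v *)
Require Import Defs.
From mathcomp Require Import all_boot all_order all_algebra.
From mathcomp Require Import all_classical all_reals all_analysis.

(** Let [f] normalize from [K] to [P], and let [g] be its inverse.  The
    pushforward [nu] of [mu] along [g] is a Borel probability measure.  It is
    [K]-invariant: given [k] in [K] there is [p] in [P] with [f k = p f], hence
    [k g = g p], so moving [nu] by [k] amounts to moving [mu] by [p], which
    fixes [mu], and then pushing along [g].  Uniqueness of the invariant
    measure gives [nu = mu], that is, [g] preserves [mu], and therefore so does
    its inverse [f].  The lemma [pushforward_invariant] is the central step. *)

Local Open Scope classical_set_scope.

Lemma continuous_measurable_borel {X Y : ptopologicalType} {f : X -> Y} :
  continuous f -> measurable_fun [set: borel X] (f : borel X -> borel Y).
Proof.
move=> /continuousP f_open.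
apply: (@measurability _ _ (borel X) (borel Y) _ _ (@open Y)) => // _ [U oU <-].
rewrite setTI; apply: sub_sigma_algebra; exact: f_open.
Qed.

(** The relation [k g = g p] makes the preimage under [g] of [k^-1 B] equal to
    that under [p] of [g^-1 B], whose measure [p] does not change.  The measure
    [nu] is a parameter, known by its values, so that any bundled form of the
    pushforward can be used for it. *)
Lemma pushforward_invariant {R : realType} {X : ptopologicalType}
    {mu nu : {measure set (borel X) -> \bar R}%R} {g k p : X -> X} :
    (forall B, nu B = mu (g @^-1` B)) -> continuous g ->
    k \o g = g \o p -> preserves mu p ->
  preserves nu k.
Proof.
move=> nuE gc kg pmu B mB.
rewrite !nuE -comp_preimage kg comp_preimage pmu //.
rewrite -[g @^-1` B]setTI.
exact: (continuous_measurable_borel gc measurableT B mB).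
Qed.

Lemma preserves_inverse {R : realType} {X : ptopologicalType}
    {mu : {measure set (borel X) -> \bar R}%R} {f g : X -> X} :
    continuous f -> cancel g f -> preserves mu g ->
  preserves mu f.
Proof.
move=> fc gK gmu B mB.
have mfB : measurable (f @^-1` B : set (borel X)).
  rewrite -[f @^-1` B]setTI.
  exact: (continuous_measurable_borel fc measurableT B mB).
rewrite -(gmu _ mfB) -comp_preimage.
by have -> : f \o g = id by apply/funext => x; exact: gK.
Qed.

Theorem theorem3p1p1 (R : realType) (X : ptopologicalType)
    (hX : compact [set: X]) (mu : probability (borel X) R)
    (P K : set (X -> X))
    (hP : P `<=` Homeo_mu mu) (hK : K `<=` Homeo_mu mu)
    (hmu : unique_invariant K mu) :
  normalizer K P `<=` Homeo_mu mu.
Proof.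
move=> f [hf fKP]; split=> //.
have [fc [g [fK gK gc]]] := hf.
pose gm : {mfun borel X >-> borel X} :=
  mfun_Sub (mem_set (continuous_measurable_borel gc)).
apply: (preserves_inverse fc gK) => B mB.
apply: (hmu.2 (distribution mu gm)) => // k Kk.
have [p Pp pf] : [set p \o f | p in P] (f \o k) by apply: fKP; exists k.
apply: (pushforward_invariant (mu := mu) (g := g) (p := p)) => //.
- apply/funext => x /=.
  (* [f k = p f] at [g x] reads [f (k (g x)) = p x]; cancel [f] with [g]. *)
  have /= pgx := congr1 (fun h => h (g x)) pf.
  by rewrite gK in pgx; rewrite pgx fK.
- exact: (hP _ Pp).2.
Qed.
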